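(* Let $M$ be a strictly totally ordered monoid, let $R$ be a ring and let $I$ be an ideal of $R$. If $I$ is a semicommutative ideal (that is, $I$ is semicommutative when regarded as a ring without identity) and $R/I$ is a lower nil $M$-Armendariz ring, then $R$ is a lower nil $M$-Armendariz ring.
   Context: Rings are associative with identity (an ideal is regarded as a ring possibly without identity). $N_*(R)$ denotes the prime radical (lower nilradical) of $R$. A ring $T$ (possibly without identity) is semicommutative if for $a,b\in T$, $ab=0$ implies $aTb=0$. A strictly totally ordered monoid is a monoid $M$ with a total order $\le$ such that for all $r_1,r_2,s\in M$, $r_1<r_2$ implies $r_1s<r_2s$ and $sr_1<sr_2$. $R[M]$ is the monoid ring of $M$ over $R$; for a subset $J\subseteq R$, $J[M]$ is the set of elements of $R[M]$ all of whose coefficients lie in $J$. A ring $R$ is lower nil $M$-Armendariz if whenever $\alpha=a_1g_1+\cdots+a_ng_n$ and $\beta=b_1h_1+\cdots+b_mh_m$ in $R[M]$ (with $a_i,b_j\in R$, the $g_i\in M$ pairwise distinct and the $h_j\in M$ pairwise distinct) satisfy $\alpha\beta\in N_*(R)[M]$, then $a_ib_j\in N_*(R)$ for all $i,j$. *)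

(* Defs.v *)
From HB Require Import structures.
From mathcomp Require Import all_boot all_order all_algebra.
From mathcomp Require Import generic_quotient ring_quotient finmap.
From mathcomp Require Import boolp classical_sets.
From mathcomp Require Import monalg.

Set Implicit Arguments.
Unset Strict Implicit.
Unset Printing Implicit Defensive.

Import GRing.Theory.

Local Open Scope classical_set_scope.
Local Open Scope quotient_scope.
Local Open Scope ring_scope.

(* [pzRingType] is associative with identity, neither commutative nor
   nontrivial, so that R / I is still a ring when I = R. *)

HB.mixin Record isStrictlyTotallyOrderedMonoid (d : Order.disp_t) M
    of Order.Total d M & Monoid M := {
  lt_mulgr : forall s r1 r2 : M, (r1 < r2)%O -> (r1 * s < r2 * s)%O%g;
  lt_mulgl : forall s r1 r2 : M, (r1 < r2)%O -> (s * r1 < s * r2)%O%g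
}.

#[short(type="stoMonoidType")]
HB.structure Definition StrictlyTotallyOrderedMonoid (d : Order.disp_t) :=
  {M of Order.Total d M & Monoid M & isStrictlyTotallyOrderedMonoid d M}.

Record ideal (R : pzRingType) := Ideal {
  ideal_set :> set R;
  ideal_zero : ideal_set 0;
  ideal_sub : forall x y, ideal_set x -> ideal_set y -> ideal_set (x - y);
  ideal_mull : forall a x, ideal_set x -> ideal_set (a * x);
  ideal_mulr : forall a x, ideal_set x -> ideal_set (x * a)
}.

(* The library's [{ideal_quot I}] requires a proper ideal of a commutative
   ring; only its underlying group [Quotient.quot] is reused here. *)
Section QuotientRing.
Variables (R : pzRingType) (I : ideal R).

Definition ideal_pred : pred R := fun x => `[< ideal_set I x >].

Lemma ideal_pred_zmod_closed : zmod_closed ideal_pred.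
Proof.
split; first by apply/asboolP; exact: ideal_zero.
by move=> x y /asboolP Ix /asboolP Iy; apply/asboolP; exact: ideal_sub.
Qed.

HB.instance Definition _ :=
  GRing.isZmodClosed.Build R ideal_pred ideal_pred_zmod_closed.

Let Iz : zmodClosed R := GRing.ZmodClosed.clone R ideal_pred _.

Definition quot_ring : Type := Quotient.quot Iz.

HB.instance Definition _ := GRing.Zmodule.on quot_ring.
HB.instance Definition _ := EqQuotient.on quot_ring.

Definition quot_one : quot_ring := \pi_quot_ring 1.
Definition quot_mul (u v : quot_ring) : quot_ring :=
  \pi_quot_ring (repr u * repr v).

Lemma quot_piP (x y : R) :
  \pi_quot_ring x = \pi_quot_ring y <-> ideal_set I (x - y).
Proof.
have E : (\pi_quot_ring x == \pi_quot_ring y) = `[< ideal_set I (x - y) >].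
  by rewrite -(@Quotient.idealrBE R Iz).
split=> [/eqP|Ixy]; first by rewrite E => /asboolP.
by apply/eqP; rewrite E; apply/asboolP.
Qed.

Lemma quot_piD : {morph \pi_quot_ring : x y / x + y >-> x + y}.
Proof. exact: (@Quotient.pi_add R Iz). Qed.

Lemma quot_piM : {morph \pi_quot_ring : x y / x * y >-> quot_mul x y}.
Proof.
move=> x y; apply/quot_piP.
set x' := repr _; set y' := repr _.
have Ix : ideal_set I (x - x') by apply/quot_piP; rewrite reprK.
have Iy : ideal_set I (y - y') by apply/quot_piP; rewrite reprK.
have -> : x * y - x' * y' = x * (y - y') - (0 - (x - x')) * y'.
  by rewrite mulrBr sub0r opprB !mulrBl opprB addrA subrK.
apply: ideal_sub; first exact: ideal_mull.
apply: ideal_mulr; apply: ideal_sub => //; exact: ideal_zero.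
Qed.

Lemma quot_mulA : associative quot_mul.
Proof.
elim/quotW=> x; elim/quotW=> y; elim/quotW=> z.
by rewrite -(quot_piM y) -(quot_piM x y) -(quot_piM x) -quot_piM mulrA.
Qed.

Lemma quot_1mul : left_id quot_one quot_mul.
Proof. by elim/quotW=> x; rewrite -quot_piM mul1r. Qed.

Lemma quot_mul1 : right_id quot_one quot_mul.
Proof. by elim/quotW=> x; rewrite -quot_piM mulr1. Qed.

Lemma quot_mulDl : left_distributive quot_mul +%R.
Proof.
elim/quotW=> x; elim/quotW=> y; elim/quotW=> z.
rewrite -(quot_piD x y) -(quot_piM (x + y)) -(quot_piM x) -(quot_piM y).
by rewrite -quot_piD mulrDl.
Qed.

Lemma quot_mulDr : right_distributive quot_mul +%R.
Proof.
elim/quotW=> x; elim/quotW=> y; elim/quotW=> z.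
rewrite -(quot_piD y z) -(quot_piM x (y + z)) -(quot_piM x y) -(quot_piM x z).
by rewrite -quot_piD mulrDr.
Qed.

HB.instance Definition _ := GRing.Zmodule_isPzRing.Build quot_ring
  quot_mulA quot_1mul quot_mul1 quot_mulDl quot_mulDr.

End QuotientRing.

Section PrimeRadical.
Variable R : pzRingType.

Definition prime_ideal (P : ideal R) : Prop :=
  (P : set R) <> [set: R] /\
  forall A B : ideal R,
    (forall a b, ideal_set A a -> ideal_set B b -> ideal_set P (a * b)) ->
    A `<=` P \/ B `<=` P.

Definition prime_radical : set R :=
  [set x | forall P : ideal R, prime_ideal P -> ideal_set P x].

End PrimeRadical.

(* A subset T closed under the ring operations is viewed as a ring without
   identity: the middle factor ranges over T only. *)
Definition semicommutative (R : pzRingType) (T : set R) : Prop :=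
  forall a b, T a -> T b -> a * b = 0 -> forall t, T t -> a * t * b = 0.

(* [{malg R[K]}] carries a ring structure in the library only when the only
   unit of K is 1 (and R is nontrivial); the convolution product is defined
   here for an arbitrary monoid. *)
Definition monoid_ring (R : pzRingType) (M : monoidType) : Type :=
  {malg R[M]}.

Section MonoidRing.
Variables (R : pzRingType) (M : monoidType).
Local Open Scope fset_scope.
Local Open Scope ring_scope.

HB.instance Definition _ := GRing.Zmodule.on (monoid_ring R M).

Implicit Types (f : monoid_ring R M) (k : M) (c : R).

Definition coeff f k : R := mcoeff k f.

Definition monom c k : monoid_ring R M := << c *g k >>.

Definition monoid_ring_one : monoid_ring R M := monom 1 1%g.

Definition monoid_ring_mul f1 f2 : monoid_ring R M :=
  \sum_(k1 <- msupp f1) \sum_(k2 <- msupp f2)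
     monom (coeff f1 k1 * coeff f2 k2) (k1 * k2)%g.

Local Notation mul := monoid_ring_mul.

Lemma monom0 k : monom 0 k = 0. Proof. exact: monalgU0. Qed.

Lemma monomD c1 c2 k : monom (c1 + c2) k = monom c1 k + monom c2 k.
Proof. exact: monalgUD. Qed.

Lemma coeffD f1 f2 k : coeff (f1 + f2) k = coeff f1 k + coeff f2 k.
Proof. exact: mcoeffD. Qed.

Lemma coeff_monom c k k' : coeff (monom c k) k' = c *+ (k == k').
Proof. exact: mcoeffU. Qed.

Lemma monoid_ringE f : f = \sum_(k <- msupp f) monom (coeff f k) k.
Proof. exact: monalgE. Qed.

Lemma monoid_ring_mulw (d1 d2 : {fset M}) f1 f2 :
  msupp f1 `<=` d1 -> msupp f2 `<=` d2 ->
  mul f1 f2 = \sum_(k1 <- d1) \sum_(k2 <- d2)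
    monom (coeff f1 k1 * coeff f2 k2) (k1 * k2)%g.
Proof.
move=> le_d1 le_d2; rewrite /mul (big_fset_incl _ le_d1) /=.
  apply/eq_bigr=> k1 _; apply/big_fset_incl => // k _ /mcoeff_outdom.
  by rewrite /coeff => ->; rewrite mulr0 monom0.
move=> k _ /mcoeff_outdom f1k.
by rewrite big1 => // k' _; rewrite /coeff f1k mul0r monom0.
Qed.

Lemma monoid_ring_mulUw c k (d : {fset M}) f : msupp f `<=` d ->
  mul (monom c k) f = \sum_(k' <- d) monom (c * coeff f k') (k * k')%g.
Proof.
move=> le_d; rewrite (@monoid_ring_mulw [fset k] d) ?msuppU_le //.
rewrite big_seq_fset1; apply/eq_bigr => k' _.
by rewrite coeff_monom eqxx mulr1n.
Qed.

Lemma monoid_ring_mulwU c k (d : {fset M}) f : msupp f `<=` d ->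
  mul f (monom c k) = \sum_(k' <- d) monom (coeff f k' * c) (k' * k)%g.
Proof.
move=> le_d; rewrite (@monoid_ring_mulw d [fset k]) ?msuppU_le //.
apply/eq_bigr => k' _; rewrite big_seq_fset1.
by rewrite coeff_monom eqxx mulr1n.
Qed.

Lemma monom_mul c1 c2 k1 k2 :
  mul (monom c1 k1) (monom c2 k2) = monom (c1 * c2) (k1 * k2)%g.
Proof.
rewrite (@monoid_ring_mulUw _ _ [fset k2]) ?msuppU_le // big_seq_fset1.
by rewrite coeff_monom eqxx mulr1n.
Qed.

Lemma monoid_ring_1mul : left_id monoid_ring_one mul.
Proof.
move=> f; rewrite (monoid_ring_mulUw _ _ (fsubset_refl _)) [RHS]monoid_ringE.
by apply/eq_bigr=> k _; rewrite mul1r mul1g.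
Qed.

Lemma monoid_ring_mul1 : right_id monoid_ring_one mul.
Proof.
move=> f; rewrite (monoid_ring_mulwU _ _ (fsubset_refl _)) [RHS]monoid_ringE.
by apply/eq_bigr=> k _; rewrite mulr1 mulg1.
Qed.

Lemma monoid_ring_mulDl : left_distributive mul +%R.
Proof.
move=> f1 f2 f; pose d := msupp f1 `|` msupp f2.
rewrite (@monoid_ring_mulw d (msupp f)) ?msuppD_le //.
rewrite (@monoid_ring_mulw d (msupp f) f1) ?fsubsetUl //.
rewrite (@monoid_ring_mulw d (msupp f) f2) ?fsubsetUr //.
rewrite -big_split /=; apply/eq_bigr=> k1 _.
rewrite -big_split /=; apply/eq_bigr=> k2 _.
by rewrite coeffD mulrDl monomD.
Qed.

Lemma monoid_ring_mulDr : right_distributive mul +%R.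
Proof.
move=> f f1 f2; pose d := msupp f1 `|` msupp f2.
rewrite (@monoid_ring_mulw (msupp f) d) ?msuppD_le //.
rewrite (@monoid_ring_mulw (msupp f) d f f1) ?fsubsetUl //.
rewrite (@monoid_ring_mulw (msupp f) d f f2) ?fsubsetUr //.
rewrite -big_split /=; apply/eq_bigr=> k1 _.
rewrite -big_split /=; apply/eq_bigr=> k2 _.
by rewrite coeffD mulrDr monomD.
Qed.

Lemma monoid_ring_0mul : left_zero 0 mul.
Proof. by move=> f; rewrite /mul msupp0 big_seq_fset0. Qed.

Lemma monoid_ring_mul0 : right_zero 0 mul.
Proof.
by move=> f; rewrite /mul big1 // => k _; rewrite msupp0 big_seq_fset0.
Qed.

Lemma monoid_ring_mul_suml (T : Type) (r : seq T) (F : T -> monoid_ring R M) f :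
  mul (\sum_(i <- r) F i) f = \sum_(i <- r) mul (F i) f.
Proof.
apply: (big_morph (mul^~ f)) => [f1 f2|]; first exact: monoid_ring_mulDl.
exact: monoid_ring_0mul.
Qed.

Lemma monoid_ring_mul_sumr (T : Type) (r : seq T) (F : T -> monoid_ring R M) f :
  mul f (\sum_(i <- r) F i) = \sum_(i <- r) mul f (F i).
Proof.
apply: (big_morph (mul f)) => [f1 f2|]; first exact: monoid_ring_mulDr.
exact: monoid_ring_mul0.
Qed.

Lemma monoid_ring_mulA : associative mul.
Proof.
move=> f1 f2 f3; rewrite [f1]monoid_ringE !monoid_ring_mul_suml.
apply/eq_bigr => k1 _; rewrite [f2]monoid_ringE.
rewrite monoid_ring_mul_suml !monoid_ring_mul_sumr monoid_ring_mul_suml.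
apply/eq_bigr => k2 _; rewrite [f3]monoid_ringE !monoid_ring_mul_sumr.
by apply/eq_bigr => k3 _; rewrite !monom_mul mulrA mulgA.
Qed.

HB.instance Definition _ := GRing.Zmodule_isPzRing.Build (monoid_ring R M)
  monoid_ring_mulA monoid_ring_1mul monoid_ring_mul1
  monoid_ring_mulDl monoid_ring_mulDr.

Definition coeffs_in (J : set R) : set (monoid_ring R M) :=
  [set f | forall k, J (coeff f k)].

End MonoidRing.

Definition lower_nil_Armendariz (M : monoidType) (R : pzRingType) : Prop :=
  forall (n m : nat) (a : 'I_n -> R) (g : 'I_n -> M)
         (b : 'I_m -> R) (h : 'I_m -> M),
    injective g -> injective h ->
    coeffs_in (@prime_radical R)
      ((\sum_i monom (a i) (g i)) * (\sum_j monom (b j) (h j))) ->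
    forall i j, prime_radical (a i * b j).

(* Main.v *)
Require Import Defs.
From mathcomp Require Import all_boot all_order all_algebra.
From mathcomp Require Import generic_quotient.
From mathcomp Require Import boolp classical_sets.
From mathcomp Require Import monalg.

(** Write N for the prime radical of R.  To get a_i b_j in N one has to put it
    in every prime ideal P.

    If P contains I, then P is the preimage of a prime ideal of R / I, and
    a_i b_j lies in P because the image of the product of the two elements of
    R[M] has its coefficients in the prime radical of R / I, where the
    Armendariz hypothesis applies.

    If P does not contain I, it suffices that a_i I b_j is contained in N,
    hence in P: primeness then puts a_i or b_j in P.  So say that a and b are
    orthogonal when a I b is contained in N ([orthogonal]).  Semicommutativity
    of I makes I / (I cap N) a reduced ring: nilpotent elements of I lie in N
    ([nilpotent_in_radical]), and N is nil by Zorn's lemma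
    ([prime_radical_nil]), so an element of I whose square is in N is in N.
    Consequently orthogonality is a symmetric relation, it follows from
    a b in N, and it forces I a b to be contained in N; it thus behaves like
    vanishing of products in a reduced ring.  The classical proof that reduced
    rings are Armendariz over a strictly ordered monoid then goes through: by
    induction on the pair (g_i h_j, g_i), ordered lexicographically, all a_i
    and b_j are orthogonal ([coefficients_orthogonal]). *)

Set Implicit Arguments.
Unset Strict Implicit.
Unset Printing Implicit Defensive.

Import Order.TTheory GRing.Theory.

Local Open Scope classical_set_scope.
Local Open Scope quotient_scope.
Local Open Scope ring_scope.

(** * Ideals and prime ideals *)

Lemma ideal_opp (R : pzRingType) (A : ideal R) x :
  ideal_set A x -> ideal_set A (- x).
Proof.
by move=> Ax; rewrite -sub0r; apply: ideal_sub => //; exact: ideal_zero.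
Qed.

Lemma ideal_add (R : pzRingType) (A : ideal R) x y :
  ideal_set A x -> ideal_set A y -> ideal_set A (x + y).
Proof.
by move=> Ax Ay; rewrite -[y]opprK; apply: ideal_sub => //; exact: ideal_opp.
Qed.

Lemma ideal_sum (R : pzRingType) (A : ideal R) (T : Type) (s : seq T)
    (Q : pred T) (F : T -> R) :
  (forall t, Q t -> ideal_set A (F t)) -> ideal_set A (\sum_(t <- s | Q t) F t).
Proof.
by move=> AF; apply: big_ind => //; [exact: ideal_zero|exact: ideal_add].
Qed.

Definition colon_middle (R : pzRingType) (P : ideal R) (b : R) : ideal R.
Proof.
exists [set u | forall r, ideal_set P (u * r * b)].
- by move=> r; rewrite !mul0r; exact: ideal_zero.
- by move=> u v Pu Pv r; rewrite !mulrBl; exact: ideal_sub.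
- by move=> c u Pu r; rewrite -!mulrA; apply: ideal_mull; rewrite mulrA.
- by move=> c u Pu r; rewrite -(mulrA u).
Defined.

Definition colon_right (R : pzRingType) (P A : ideal R) : ideal R.
Proof.
exists [set v | forall u, ideal_set A u -> ideal_set P (u * v)].
- by move=> u _; rewrite mulr0; exact: ideal_zero.
- by move=> v w Pv Pw u Au; rewrite mulrBr; apply: ideal_sub; auto.
- by move=> c v Pv u Au; rewrite mulrA; apply: Pv; exact: ideal_mulr.
- by move=> c v Pv u Au; rewrite mulrA; apply: ideal_mulr; exact: Pv.
Defined.

(** If a R b is contained in P, then a and b lie in two ideals with product in
    P: the colon ideal of the u with u R b in P, and the right colon of P by
    that ideal.  They replace the principal ideals generated by a and b, which
    would have to be described by finite sums. *)
Lemma prime_idealP (R : pzRingType) (P : ideal R) :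
  prime_ideal P <->
  (P : set R) <> [set: R] /\
  forall a b, (forall r, ideal_set P (a * r * b)) ->
    ideal_set P a \/ ideal_set P b.
Proof.
split=> -[PT primeP]; split=> //.
  move=> a b Pab; pose A := colon_middle P b.
  have [|AP|BP] := primeP A (colon_right P A).
  - by move=> u v Au Bv; exact: Bv.
  - by left; apply: AP.
  - by right; apply: BP => u Au; have := Au 1; rewrite mulr1.
move=> A B AB; have [|/existsNP[a /not_implyP[Aa NPa]]] := pselect (A `<=` P).
  by left.
right=> b Bb; have [|//|//] := primeP a b.
by move=> r; apply: AB => //; exact: ideal_mulr.
Qed.

(** Pick x in I outside P: as a R x R b is contained in a I b, hence in P,
    either b or all of a R x lies in P. *)
Lemma prime_ideal_split (R : pzRingType) (P I : ideal R) (a b : R) :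
  prime_ideal P -> ~ I `<=` P ->
  (forall x, ideal_set I x -> ideal_set P (a * x * b)) ->
  ideal_set P a \/ ideal_set P b.
Proof.
move=> /prime_idealP[_ primeP] /existsNP[x /not_implyP[Ix NPx]] Pab.
have [Pb|NPb] := pselect (ideal_set P b); [by right|left].
have Pax r : ideal_set P (a * r * x).
  have [s|//|//] := primeP (a * r * x) b.
  by rewrite -(mulrA a) -(mulrA a); apply: Pab; apply/ideal_mulr/ideal_mull.
by have [//|//|] := primeP a x.
Qed.

Definition prime_radical_ideal (R : pzRingType) : ideal R.
Proof.
exists (@prime_radical R).
- by move=> P _; exact: ideal_zero.
- by move=> x y Nx Ny P primeP; apply: ideal_sub; [exact: Nx|exact: Ny].
- by move=> a x Nx P primeP; apply: ideal_mull; exact: Nx.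
- by move=> a x Nx P primeP; apply: ideal_mulr; exact: Nx.
Defined.

Lemma radical_mull (R : pzRingType) (a x : R) :
  prime_radical x -> prime_radical (a * x).
Proof. exact: (@ideal_mull _ (prime_radical_ideal R)). Qed.

Lemma radical_mulr (R : pzRingType) (a x : R) :
  prime_radical x -> prime_radical (x * a).
Proof. exact: (@ideal_mulr _ (prime_radical_ideal R)). Qed.

(** * The prime radical is nil *)

Definition ideal_sum2 (R : pzRingType) (A B : ideal R) : ideal R.
Proof.
exists [set x | exists u v, [/\ ideal_set A u, ideal_set B v & x = u + v]].
- by exists 0, 0; split; [exact: ideal_zero|exact: ideal_zero|rewrite addr0].
- move=> _ _ [u [v [Au Bv ->]]] [u' [v' [Au' Bv' ->]]].
  exists (u - u'), (v - v').
  by split; [exact: ideal_sub..|rewrite opprD addrACA].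
- move=> c _ [u [v [Au Bv ->]]]; exists (c * u), (c * v).
  by split; [exact: ideal_mull..|rewrite mulrDr].
- move=> c _ [u [v [Au Bv ->]]]; exists (u * c), (v * c).
  by split; [exact: ideal_mulr..|rewrite mulrDl].
Defined.

Definition avoids_powers (R : pzRingType) (x : R) (A : set R) : Prop :=
  forall n, ~ A (x ^+ n).

(** Closure under the ideal operations without membership of zero: the empty
    chain has an empty union, which has to be admitted when Zorn's lemma is
    applied. *)
Definition pre_ideal (R : pzRingType) (A : set R) : Prop :=
  [/\ forall u v, A u -> A v -> A (u - v),
      forall c u, A u -> A (c * u)
    & forall c u, A u -> A (u * c)].

Lemma exists_maximal_avoiding (R : pzRingType) (x : R) :
  (forall n, x ^+ n <> 0) ->
  exists P : ideal R, avoids_powers x P /\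
    forall B : ideal R, P `<=` B -> avoids_powers x B -> B `<=` P.
Proof.
move=> xn0; pose Q (A : set R) := pre_ideal A /\ avoids_powers x A.
have [|A [[[Asub Al Ar] Ax] Amax]] := @Zorn_bigcup R Q.
  move=> F FQ Ftot; split; last first.
    by move=> n [B FB]; case: (FQ _ FB) => _; exact.
  split=> [u v [B FB Bu] [C FC Cv]|c u [B FB Bu]|c u [B FB Bu]].
  - have [BC|CB] := Ftot _ _ FB FC.
      by exists C => //; case: (FQ _ FC) => -[Csub _ _] _; apply: Csub; auto.
    by exists B => //; case: (FQ _ FB) => -[Bsub _ _] _; apply: Bsub; auto.
  - by exists B => //; case: (FQ _ FB) => -[_ Bl _] _; exact: Bl.
  - by exists B => //; case: (FQ _ FB) => -[_ _ Br] _; exact: Br.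
have A0 : A 0.
  apply: contrapT => NA0; apply: (Amax [set 0]).
    split=> [u Au|/(_ 0 erefl)//].
    by case: NA0; rewrite -(subrr u); exact: Asub.
  split; last by move=> n /xn0.
  by split=> [u v -> ->|c u ->|c u ->]; rewrite /= ?subrr ?mulr0 ?mul0r.
exists (Ideal A0 Asub Al Ar); split=> // B AB Bx; apply: contrapT => NBA.
apply: (Amax B); first by split.
split=> //; split; [exact: ideal_sub|exact: ideal_mull|exact: ideal_mulr].
Qed.

(** An ideal maximal among those containing no power of x is prime: two ideals
    not inside it produce powers of x, whose product is again a power. *)
Lemma prime_radical_nil (R : pzRingType) (x : R) :
  prime_radical x -> exists n, x ^+ n = 0.
Proof.
move=> Nx; apply: contrapT => /forallNP/exists_maximal_avoiding[P [Px Pmax]].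
suff primeP : prime_ideal P by apply: (Px 1%N); rewrite expr1; exact: Nx.
split=> [PT|A B AB]; first by apply: (Px 0%N); rewrite PT.
have power (C : ideal R) : ~ C `<=` P ->
    exists n p c, [/\ ideal_set P p, ideal_set C c & x ^+ n = p + c].
  move=> NCP; apply: contrapT => Nn; apply: NCP => c Cc.
  apply: (Pmax (ideal_sum2 P C)).
  - by move=> p Pp; exists p, 0; split=> //; [exact: ideal_zero|rewrite addr0].
  - by move=> n [p [c' H]]; apply: Nn; exists n, p, c'.
  - by exists 0, c; split=> //; [exact: ideal_zero|rewrite add0r].
apply: contrapT => /not_orP[/power[m [p [a [Pp Aa xm]]]]].
move=> /power[n [q [b [Pq Bb xn]]]]; apply: (Px (m + n)%N).
rewrite exprD xm xn mulrDl; apply: ideal_add; first exact: ideal_mulr.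
by rewrite mulrDr; apply: ideal_add; [exact: ideal_mull|exact: AB].
Qed.

(** * Semicommutative ideals modulo the prime radical *)

(** Let P be a prime not containing I.  From c z^(k+1) = 0 semicommutativity
    gives (c t z) z^k = 0 for all t in I; by induction on k all c t z lie in P
    unless z does, and then c or z lies in P. *)
Lemma nilpotent_in_radical (R : pzRingType) (I : ideal R) (z : R) (n : nat) :
  semicommutative I -> ideal_set I z -> z ^+ n = 0 -> prime_radical z.
Proof.
move=> scI Iz zn P primeP.
have [IP|NIP] := pselect (I `<=` P); first exact: IP.
have key k c :
    ideal_set I c -> c * z ^+ k = 0 -> ideal_set P c \/ ideal_set P z.
  elim: k c => [|k IH] c Ic.
    by rewrite mulr1 => ->; left; exact: ideal_zero.
  move=> czk; have [Pz|NPz] := pselect (ideal_set P z); [by right|left].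
  have [t It|//|//] := prime_ideal_split (a := c) (b := z) primeP NIP.
  have [||//|//] := IH (c * t * z); first exact: ideal_mull.
  rewrite -mulrA -exprS; apply: scI => //.
  by rewrite exprSr; exact: ideal_mull.
have [|//|//] := key n z Iz.
by rewrite -exprS exprSr zn mul0r.
Qed.

Lemma square_in_radical (R : pzRingType) (I : ideal R) (z : R) :
  semicommutative I -> ideal_set I z ->
  prime_radical (z * z) -> prime_radical z.
Proof.
move=> scI Iz /prime_radical_nil[n]; rewrite -expr2 -exprM.
exact: (nilpotent_in_radical scI Iz).
Qed.

(** Modulo the primes that do not contain I, the ideal I has no nonzero z with
    z I z = 0; the primes that contain I contain z anyway. *)
Lemma sandwich_in_radical (R : pzRingType) (I : ideal R) (z : R) :
  ideal_set I z -> (forall x, ideal_set I x -> prime_radical (z * x * z)) ->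
  prime_radical z.
Proof.
move=> Iz zIz P primeP.
have [IP|NIP] := pselect (I `<=` P); first exact: IP.
have [x Ix|//|//] := prime_ideal_split (a := z) (b := z) primeP NIP.
exact: zIz.
Qed.

Definition orthogonal (R : pzRingType) (I : ideal R) (a b : R) : Prop :=
  forall x, ideal_set I x -> prime_radical (a * x * b).

(** The element z = b x a satisfies z y z = b x (a y b) x a. *)
Lemma orthogonal_sym (R : pzRingType) (I : ideal R) (a b : R) :
  orthogonal I a b -> orthogonal I b a.
Proof.
move=> ab x Ix; apply: (sandwich_in_radical (I := I)).
  by apply/ideal_mulr/ideal_mull.
move=> y Iy.
have -> : b * x * a * y * (b * x * a) = b * x * (a * y * b) * (x * a).
  by rewrite !mulrA.
by apply/radical_mulr/radical_mull/ab.
Qed.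

(** This is where reducedness of I modulo the radical enters: the square of
    b x a contains the factor a b. *)
Lemma orthogonal_of_mul (R : pzRingType) (I : ideal R) (a b : R) :
  semicommutative I -> prime_radical (a * b) -> orthogonal I a b.
Proof.
move=> scI ab; apply: orthogonal_sym => x Ix.
apply: (square_in_radical scI); first by apply/ideal_mulr/ideal_mull.
have -> : b * x * a * (b * x * a) = b * x * (a * b) * (x * a) by rewrite !mulrA.
by apply/radical_mulr/radical_mull.
Qed.

Lemma orthogonal_mul (R : pzRingType) (I : ideal R) (a b c : R) :
  ideal_set I c -> orthogonal I a b -> prime_radical (c * a * b).
Proof.
move=> Ic /orthogonal_sym ba; apply: (sandwich_in_radical (I := I)).
  by apply/ideal_mulr/ideal_mulr.
move=> y Iy.
have -> : c * a * b * y * (c * a * b) = c * a * (b * (y * c) * a) * b.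
  by rewrite !mulrA.
by apply/radical_mulr/radical_mull/ba/ideal_mulr.
Qed.

(** By hypothesis (a x a) b is in the radical, so a x a is orthogonal to b; for
    z = a y b the product z x z = a (y b x) a y b has this form. *)
Lemma orthogonal_of_sandwich (R : pzRingType) (I : ideal R) (a b : R) :
  semicommutative I ->
  (forall x, ideal_set I x -> prime_radical (a * x * a * b)) ->
  orthogonal I a b.
Proof.
move=> scI aIab y Iy; apply: (sandwich_in_radical (I := I)).
  by apply/ideal_mulr/ideal_mull.
move=> x Ix.
have -> : a * y * b * x * (a * y * b) = a * (y * b * x) * a * y * b.
  by rewrite !mulrA.
by apply: (orthogonal_of_mul scI) => //; apply/aIab/ideal_mull.
Qed.

(** * Products in the monoid ring *)

Lemma coeff_sum (R : pzRingType) (M : monoidType) (T : Type) (s : seq T)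
    (F : T -> monoid_ring R M) (k : M) :
  coeff (\sum_(t <- s) F t) k = \sum_(t <- s) coeff (F t) k.
Proof.
apply: (big_morph (fun f => coeff f k)) => [f1 f2|]; first exact: coeffD.
exact: mcoeff0.
Qed.

Lemma coeff_mul_sum (R : pzRingType) (M : monoidType) (n m : nat)
    (a : 'I_n -> R) (g : 'I_n -> M) (b : 'I_m -> R) (h : 'I_m -> M) (k : M) :
  coeff ((\sum_i monom (a i) (g i)) * (\sum_j monom (b j) (h j))) k =
  \sum_(p : 'I_n * 'I_m | (g p.1 * h p.2)%g == k) a p.1 * b p.2.
Proof.
rewrite mulr_suml coeff_sum.
rewrite -(pair_big_dep xpredT (fun i j => (g i * h j)%g == k)
            (fun i j => a i * b j)) /=.
apply: eq_bigr => i _; rewrite mulr_sumr coeff_sum [RHS]big_mkcond /=.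
apply: eq_bigr => j _; rewrite [_ * _]monom_mul coeff_monom.
by case: eqP.
Qed.

Lemma fin_order_ind (T : finType) (d : Order.disp_t) (L : orderType d)
    (f : T -> L) (Q : T -> Prop) :
  (forall q, (forall p, (f p < f q)%O -> Q p) -> Q q) -> forall q, Q q.
Proof.
move=> step q; have [k] := ubnP #|[pred p | (f p < f q)%O]|.
elim: k q => // k IH q; rewrite ltnS => cardq; apply: step => p pq.
apply: IH; apply: leq_trans cardq; apply: proper_card.
apply/properP; split.
  by apply/fintype.subsetP => r; rewrite !inE => /lt_trans ->.
by exists p; rewrite !inE ?ltxx.
Qed.

(** Multiply the coefficient of g_i0 h_j0 in the product by a_i0 x on the left,
    with x in I.  Every term a_i0 x a_i1 b_j1 other than the one at (i0, j0)
    contains an orthogonal pair treated before: a_i1 and b_j1 if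
    g_i1 < g_i0, and a_i0 and b_j1 if g_i1 > g_i0, since the spare factor
    x a_i1 still lies in I.  What remains is a_i0 x a_i0 b_j0, which is enough
    by [orthogonal_of_sandwich]. *)
Lemma coefficients_orthogonal (d : Order.disp_t) (M : stoMonoidType d)
    (R : pzRingType) (I : ideal R) (n m : nat)
    (a : 'I_n -> R) (g : 'I_n -> M) (b : 'I_m -> R) (h : 'I_m -> M) :
  semicommutative I -> injective g -> injective h ->
  (forall k, prime_radical
     (\sum_(p : 'I_n * 'I_m | (g p.1 * h p.2)%g == k) a p.1 * b p.2)) ->
  forall i j, orthogonal I (a i) (b j).
Proof.
move=> scI injg injh Nab i j.
pose f (p : 'I_n * 'I_m) : (M *l M)%type := ((g p.1 * h p.2)%g, g p.1).
suff: forall p, orthogonal I (a p.1) (b p.2) by move=> /(_ (i, j)).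
apply: (@fin_order_ind _ _ _ f) => -[i0 j0] /= IH.
apply: orthogonal_of_sandwich => // x Ix.
have := radical_mull (a i0 * x) (Nab (g i0 * h j0)%g).
rewrite (bigD1 (i0, j0)) //= mulrDr mulrA => Nsum.
rewrite -(addrK (a i0 * x * \sum_(p | ((g p.1 * h p.2)%g == (g i0 * h j0)%g) &&
  (p != (i0, j0))) a p.1 * b p.2) (a i0 * x * a i0 * b j0)).
apply: (@ideal_sub _ (prime_radical_ideal R)) => //=.
rewrite mulr_sumr; apply: (@ideal_sum _ (prime_radical_ideal R)).
move=> [i1 j1] /= /andP[/eqP prodE neq]; rewrite mulrA.
have [g10|g01|g10] := ltgtP (g i1) (g i0).
- (* (i1, j1) precedes (i0, j0) by its second component g i1 *)
  apply: (orthogonal_mul (I := I)); first exact: ideal_mull.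
  by apply: (IH (i1, j1)); rewrite ltxi_pair /= prodE lexx /=.
- (* g i0 * h j1 is below the current product: (i0, j1) precedes (i0, j0) *)
  rewrite -(mulrA (a i0)); apply: (IH (i0, j1)); last exact: ideal_mulr.
  by rewrite ltxi_pair /= -prodE; have := lt_mulgr (h j1) _ _ g01; case: ltgtP.
- (* cancellation in M forces the pair (i0, j0), which is excluded *)
  have i10 := injg _ _ g10; move: prodE neq; rewrite i10 => prodE.
  suff -> : j1 = j0 by rewrite eqxx.
  apply: injh; have [lt|lt|//] := ltgtP (h j1) (h j0);
    by have := lt_mulgl (g i0) _ _ lt; rewrite prodE ltxx.
Qed.

(** * Passing to the quotient *)

Lemma quot_pi0 (R : pzRingType) (I : ideal R) : \pi_(quot_ring I) 0 = 0.
Proof.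
by apply: (addrI (\pi_(quot_ring I) 0)); rewrite -quot_piD !addr0.
Qed.

Lemma quot_piB (R : pzRingType) (I : ideal R) (x y : R) :
  \pi_(quot_ring I) (x - y) = \pi_(quot_ring I) x - \pi_(quot_ring I) y.
Proof.
by apply: (addIr (\pi_(quot_ring I) y)); rewrite -quot_piD !subrK.
Qed.

Lemma quot_pi_mul (R : pzRingType) (I : ideal R) (x y : R) :
  \pi_(quot_ring I) (x * y) = \pi_(quot_ring I) x * \pi_(quot_ring I) y.
Proof. exact: quot_piM. Qed.

Lemma quot_pi_sum (R : pzRingType) (I : ideal R) (T : Type) (s : seq T)
    (Q : pred T) (F : T -> R) :
  \pi_(quot_ring I) (\sum_(t <- s | Q t) F t) =
  \sum_(t <- s | Q t) \pi_(quot_ring I) (F t).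
Proof. exact: (big_morph _ (@quot_piD R I) (quot_pi0 I)). Qed.

Definition preimage_ideal (R : pzRingType) (I : ideal R)
  (Q : ideal (quot_ring I)) : ideal R.
Proof.
exists [set x | ideal_set Q (\pi_(quot_ring I) x)].
- by rewrite /= quot_pi0; exact: ideal_zero.
- by move=> x y Qx Qy; rewrite /= quot_piB; exact: ideal_sub.
- by move=> a x Qx; rewrite /= quot_pi_mul; exact: ideal_mull.
- by move=> a x Qx; rewrite /= quot_pi_mul; exact: ideal_mulr.
Defined.

Lemma preimage_prime (R : pzRingType) (I : ideal R) (Q : ideal (quot_ring I)) :
  prime_ideal Q -> prime_ideal (preimage_ideal Q).
Proof.
move=> /prime_idealP[QT primeQ]; apply/prime_idealP; split=> [PT|x y Pxy].
  apply: QT; rewrite -subTset; elim/quotW => x _.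
  have : ideal_set (preimage_ideal Q) x by rewrite PT.
  by [].
by apply: primeQ; elim/quotW => r; have := Pxy r; rewrite /= !quot_pi_mul.
Qed.

Lemma prime_radical_pi (R : pzRingType) (I : ideal R) (x : R) :
  prime_radical x -> prime_radical (\pi_(quot_ring I) x).
Proof. by move=> Nx Q primeQ; exact: (Nx _ (preimage_prime primeQ)). Qed.

Lemma ideal_repr_pi (R : pzRingType) (I P : ideal R) (x : R) : I `<=` P ->
  ideal_set P (repr (\pi_(quot_ring I) x)) <-> ideal_set P x.
Proof.
move=> IP; have Pd : ideal_set P (x - repr (\pi_(quot_ring I) x)).
  by apply/IP/quot_piP; rewrite reprK.
split=> Px.
  by rewrite -[x](subrK (repr (\pi_(quot_ring I) x))); exact: ideal_add.
rewrite -[repr _](subKr x); exact: ideal_sub.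
Qed.

(** The image P / I, tested on representatives: as P contains I, the choice of
    the representative does not matter. *)
Definition image_ideal (R : pzRingType) (I P : ideal R) (IP : I `<=` P) :
  ideal (quot_ring I).
Proof.
refine (@Ideal (quot_ring I) [set u | ideal_set P (repr u)] _ _ _ _).
- by rewrite /= -quot_pi0 ideal_repr_pi //; exact: ideal_zero.
- elim/quotW => x; elim/quotW => y; rewrite /= -quot_piB !ideal_repr_pi //.
  exact: ideal_sub.
- elim/quotW => a; elim/quotW => x; rewrite /= -quot_pi_mul !ideal_repr_pi //.
  exact: ideal_mull.
- elim/quotW => a; elim/quotW => x; rewrite /= -quot_pi_mul !ideal_repr_pi //.
  exact: ideal_mulr.
Defined.

Lemma image_prime (R : pzRingType) (I P : ideal R) (IP : I `<=` P) :
  prime_ideal P -> prime_ideal (image_ideal IP).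
Proof.
move=> /prime_idealP[PT primeP]; apply/prime_idealP; split=> [QT|].
  apply: PT; rewrite -subTset => x _; apply/(ideal_repr_pi x IP).
  have : ideal_set (image_ideal IP) (\pi_(quot_ring I) x) by rewrite QT.
  by [].
elim/quotW => x; elim/quotW => y Qxy; rewrite /= !ideal_repr_pi //.
apply: primeP => r; apply/(ideal_repr_pi _ IP); rewrite !quot_pi_mul.
exact: Qxy.
Qed.

Lemma prime_above_radical_pi (R : pzRingType) (I P : ideal R) (x : R) :
  prime_ideal P -> I `<=` P -> prime_radical (\pi_(quot_ring I) x) ->
  ideal_set P x.
Proof.
move=> primeP IP Nx; apply/(ideal_repr_pi x IP).
exact: (Nx _ (image_prime IP primeP)).
Qed.

(** * The transfer theorem *)

Theorem theorem2p5 (d : Order.disp_t) (M : stoMonoidType d)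
    (R : pzRingType) (I : ideal R) :
  semicommutative I ->
  lower_nil_Armendariz M (quot_ring I) ->
  lower_nil_Armendariz M R.
Proof.
move=> scI armQ n m a g b h injg injh Nab i j P primeP.
have Nsum k : prime_radical
    (\sum_(p : 'I_n * 'I_m | (g p.1 * h p.2)%g == k) a p.1 * b p.2).
  by rewrite -coeff_mul_sum; exact: Nab.
have [IP|NIP] := pselect (I `<=` P); last first.
  have ortho := coefficients_orthogonal scI injg injh Nsum.
  have [x Ix|Pa|Pb] := prime_ideal_split (a := a i) (b := b j) primeP NIP.
  - exact: ortho.
  - exact: ideal_mulr.
  - exact: ideal_mull.
apply: (prime_above_radical_pi primeP IP); rewrite quot_pi_mul.
apply: (armQ n m (fun i => \pi_(quot_ring I) (a i)) g
  (fun j => \pi_(quot_ring I) (b j)) h injg injh) => k.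
have := prime_radical_pi (I := I) (Nsum k); rewrite coeff_mul_sum quot_pi_sum.
by under eq_bigr do rewrite quot_pi_mul.
Qed.
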